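(* For every $r\in\{1,\infty\}$ and every $N\in\{0,2,3,\ldots\}$, the group $\mathbb{G}_r(N)$ is extremely amenable.
   Context: All groups are written additively. A value on a group $G$ is a function $p\colon G\to[0,\infty)$ with $p(x)=0\iff x=0$, $p(-x)=p(x)$, and $p(x+y)\le p(x)+p(y)$ for all $x,y\in G$. A value induces the metric $d_p(x,y)=p(x-y)$, and metric and topological notions for a valued group $(G,p)$ refer to $d_p$. Isometric group homomorphisms, embeddings and isomorphisms are group homomorphisms, embeddings and isomorphisms preserving the values. A valued Abelian group $(G,p)$ is of class $\mathcal{O}_0$ if $\lim_{n\to\infty}p(nx)/n=0$ for every $x\in G$. Let $\mathfrak{G}_\infty(0)$ be the class of all separable valued Abelian groups of class $\mathcal{O}_0$, and $\mathfrak{G}_1(0)$ the subclass of those $(G,p)$ with $p\le 1$. For $N\ge 2$, let $\mathfrak{G}_\infty(N)$ be the subclass of $\mathfrak{G}_\infty(0)$ of groups of exponent dividing $N$ (i.e. $Nx=0$ for all $x$), and $\mathfrak{G}_1(N)=\mathfrak{G}_\infty(N)\cap\mathfrak{G}_1(0)$. For $r\in\{1,\infty\}$ and $N\in\{0,2,3,\ldots\}$, $\mathbb{G}_r(N)$ denotes the valued Abelian group which is unique, up to isometric group isomorphism, with the following properties (its existence and uniqueness is a theorem of Niemiec): (1) $\mathbb{G}_r(N)$ is complete and belongs to $\mathfrak{G}_r(N)$; (2) every finite valued group in $\mathfrak{G}_r(N)$ admits an isometric group embedding into $\mathbb{G}_r(N)$; (3) every isometric group homomorphism between two finite subgroups of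 $\mathbb{G}_r(N)$ extends to an isometric group homomorphism of $\mathbb{G}_r(N)$ onto itself; (4) if $N=0$, the elements of finite order form a dense subgroup of $\mathbb{G}_r(N)$. A topological group is extremely amenable if every continuous action of it on a nonempty compact Hausdorff space has a fixed point. *)

(* Defs.v *)
From HB Require Import structures.
From mathcomp Require Import all_boot all_order all_algebra.
From mathcomp Require Import all_classical all_reals all_analysis.

Set Implicit Arguments.
Unset Strict Implicit.
Unset Printing Implicit Defensive.

Import Order.TTheory GRing.Theory Num.Theory.
Import numFieldNormedType.Exports.

Local Open Scope classical_set_scope.
Local Open Scope ring_scope.

(* A value is not a norm in the sense of normedZmodType, which would require
   value (x *+ n) = value x *+ n. *)
HB.mixin Record Zmodule_isValued (R : realType) G & GRing.Zmodule G := {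
  value : G -> R ;
  value_ge0 : forall x, 0 <= value x ;
  value_eq0 : forall x, value x = 0 <-> x = 0 ;
  valueN : forall x, value (- x) = value x ;
  ler_valueD : forall x y, value (x + y) <= value x + value y
}.

#[short(type="valuedZmodType")]
HB.structure Definition ValuedZmodule (R : realType) :=
  {G of GRing.Zmodule G & Zmodule_isValued R G}.

(* Every valued group is a metric space, hence a topological group, for the
   distance of its value. *)
Section value_metric.
Context (R : realType) (G : valuedZmodType R).

Definition value_dist (x y : G) : R := value (x - y).

Let value_distxx x : value_dist x x = 0.
Proof. by rewrite /value_dist subrr; apply/value_eq0. Qed.

Let value_dist_positivity x y : value_dist x y = 0 -> x = y.
Proof. by move/value_eq0/eqP; rewrite subr_eq0 => /eqP. Qed.

Let value_dist_sym x y : value_dist x y = value_dist y x.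
Proof. by rewrite /value_dist -valueN opprB. Qed.

Let value_dist_triangle y x z :
  value_dist x z <= value_dist x y + value_dist y z.
Proof. by rewrite /value_dist -(subrKA y); exact: ler_valueD. Qed.

#[non_forgetful_inheritance]
HB.instance Definition _ := isMetric.Build R G
  value_distxx value_dist_positivity value_dist_sym value_dist_triangle.

Lemma mdist_value (x y : G) : mdist x y = value (x - y).
Proof. by []. Qed.

Let value_sub_continuous : continuous (fun x : G * G => x.1 - x.2).
Proof.
move=> [a b]; apply/metricType_numDomainType.cvgrPdist_lt => e e0 /=.
near=> x; rewrite mdist_value.
have -> : a - b - (x.1 - x.2) = (a - x.1) + (x.2 - b).
  by rewrite opprB addrACA [RHS]addrAC -!addrA; congr (_ + _); rewrite addrCA.
rewrite (le_lt_trans (ler_valueD _ _))// [e]splitr ltrD//; near: x.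
- suff : nbhs a [set y : G | value (a - y) < e / 2] by exact: cvg_fst.
  rewrite -metricType_numDomainType.filter_from_mdist_nbhs.
  by exists (e / 2); rewrite //= divr_gt0.
- suff : nbhs b [set y : G | value (y - b) < e / 2] by exact: cvg_snd.
  rewrite -metricType_numDomainType.filter_from_mdist_nbhs.
  exists (e / 2) => /=; first by rewrite divr_gt0.
  by move=> y /=; rewrite mdist_value -valueN opprB.
Unshelve. all: by end_near. Qed.

#[non_forgetful_inheritance]
HB.instance Definition _ :=
  PreTopologicalNmodule_isTopologicalZmodule.Build G value_sub_continuous.

End value_metric.

Definition separable_space (T : topologicalType) :=
  exists D : set T, countable D /\ dense D.

Definition complete_space (T : uniformType) :=
  forall F : set_system T, ProperFilter F -> cauchy F -> exists l : T, F --> l.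

Definition isometric (R : realType) (G H : valuedZmodType R) (f : G -> H) :=
  forall x, value (f x) = value x.

(* The term n = 0 is a division by zero, with value 0. *)
Definition class_O0 (R : realType) (G : valuedZmodType R) :=
  forall x : G, value (x *+ n) / n%:R @[n --> \oo] --> (0 : R).

(* The classes 𝔊_r(N). The bound r is an extended real: r = +oo imposes no
   bound, and N = 0 imposes no condition on the exponent. *)
Definition frakG (R : realType) (r : \bar R) (N : nat) (G : valuedZmodType R) :=
  [/\ separable_space G, class_O0 G, forall x : G, x *+ N = 0
    & forall x : G, ((value x)%:E <= r)%E].

Definition finite_subgroup (G : zmodType) (A : set G) :=
  finite_set A /\ zmod_closed (mem A).

Definition finitely_universal (R : realType) (r : \bar R) (N : nat)
    (G : valuedZmodType R) :=
  forall H : valuedZmodType R, finite_set [set: H] -> frakG r N H ->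
  exists f : {additive H -> G}, isometric f.

(* A homomorphism between subgroups A and B is the restriction to A of a
   function f : G -> G whose values outside A are irrelevant. *)
Definition finitely_homogeneous (R : realType) (G : valuedZmodType R) :=
  forall (A B : set G) (f : G -> G),
  finite_subgroup A -> finite_subgroup B -> f @` A `<=` B ->
  {in A &, {morph f : x y / x + y}} ->
  {in A, forall x, value (f x) = value x} ->
  exists F : {additive G -> G},
    [/\ isometric F, range F = [set: G] & {in A, F =1 f}].

Definition torsion_set (G : zmodType) : set G :=
  [set x | exists2 n, (0 < n)%N & x *+ n = 0].

(* The properties that characterize 𝔾_r(N) up to isometric isomorphism. *)
Definition is_bbG (R : realType) (r : \bar R) (N : nat)
    (G : valuedZmodType R) :=
  [/\ complete_space G /\ frakG r N G,
      finitely_universal r N G,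
      finitely_homogeneous G
    & N = 0%N -> dense (@torsion_set G)].

Definition continuous_action (G : topologicalZmodType) (X : topologicalType)
    (act : G -> X -> X) :=
  [/\ forall x, act 0 x = x,
      forall g h x, act (g + h) x = act g (act h x)
    & continuous (fun gx : G * X => act gx.1 gx.2)].

Definition extremely_amenable (G : topologicalZmodType) :=
  forall (X : topologicalType) (act : G -> X -> X),
  compact [set: X] -> hausdorff_space X -> [set: X] !=set0 ->
  continuous_action act -> exists x, forall g, act g x = x.

(* Main.v *)
From HB Require Import structures.
Require Import Defs.
From mathcomp Require Import all_boot all_order all_algebra.
From mathcomp Require Import all_classical all_reals all_analysis.
From mathcomp Require Import finmap lra ring.

(** Extreme amenability comes from concentration of measure on finite
    subgroups of [G]. Let [g] be a torsion element, let [T] be the finite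
    cyclic group that it generates and give [T ^ n] the mean of the values of
    the coordinates. This is a finite valued group with the exponent and the
    bound of [G], and the diagonal embeds [T] isometrically into it. By
    universality [T ^ n] embeds into [G], and by homogeneity the embedding can
    be corrected so that the diagonal copy of [g] is [g] itself
    ([mean_power_embedding]).

    In [T ^ n] a change of one coordinate moves a point by at most a constant
    over [n], so a Lipschitz function changes by [O(1 / n)], and its variance,
    being at most the sum of the variances along the [n] coordinates
    ([sum_sqr_diff_cube]), tends to [0]. Translation by the diagonal element
    preserves the counting measure, hence for some [h] every member of a given
    finite family of Lipschitz functions takes nearly the same value at [h] and
    at [h + g] ([exists_nearly_invariant_point]). Uniformly continuous
    functions with values in [[0, 1]] are uniform limits of Lipschitz ones
    ([lipschitz_approximation]), so they have the same property: this is
    [torsion_concentrating].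

    For an action on a compact space, apply this to the functions
    [h |-> f (h x)] with [f] continuous. If [g] moved every point of a closed
    invariant set [Y], finitely many Urysohn functions would witness it on all
    of [Y], a contradiction. So [g] has a fixed point in [Y]
    ([concentrating_fixed_point]). As [G] is Abelian, the fixed points of
    [g] in [Y] form again a closed invariant set, which is why it suffices to
    treat one element at a time: finitely many torsion elements have a common
    fixed point by induction, all of them have one by compactness, and it is
    fixed by [G] because the torsion elements are dense. *)

Set Implicit Arguments.
Unset Strict Implicit.
Unset Printing Implicit Defensive.

Import Order.TTheory GRing.Theory Num.Theory.
Import numFieldNormedType.Exports.

Local Open Scope classical_set_scope.
Local Open Scope ring_scope.

(** * Variance on finite powers *)

Section variance.
Variable R : realFieldType.

(** The double sum is twice the variance up to normalization; in this form no
    division by a cardinal appears. *)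
Lemma sum_sqr_diff (T : finType) (f : T -> R) :
  \sum_x \sum_y (f x - f y) ^+ 2
  = (#|T|%:R * (\sum_x f x ^+ 2) - (\sum_x f x) ^+ 2) *+ 2.
Proof.
under eq_bigr => x _.
  under eq_bigr => y _ do rewrite sqrrB addrAC.
  rewrite big_split /= big_split /= sumr_const -mulr_natl sumrN sumrMnl.
  rewrite -mulr_sumr.
  over.
rewrite !big_split /= -mulr_sumr sumr_const -mulr_natl sumrN sumrMnl -mulr_suml.
by ring.
Qed.

Definition ffcons n (T : finType) (a : T) (x : {ffun 'I_n -> T}) :
    {ffun 'I_n.+1 -> T} :=
  [ffun i => if unlift ord0 i is Some j then x j else a].

Lemma sum_ffcons n (T : finType) (f : {ffun 'I_n.+1 -> T} -> R) :
  \sum_x f x = \sum_x \sum_a f (ffcons a x).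
Proof.
rewrite pair_big /=.
rewrite (reindex (fun p : {ffun 'I_n -> T} * T => ffcons p.2 p.1)) //=.
exists (fun x => ([ffun j => x (lift ord0 j)], x ord0)) => [[x a]|x] _ /=.
  congr pair; last by rewrite ffunE unlift_none.
  by apply/ffunP => j; rewrite !ffunE liftK.
apply/ffunP => i; rewrite ffunE; case: unliftP => [j|] -> //.
by rewrite ffunE.
Qed.

Lemma sum_sqr_diff_le (T : finType) (f : T -> R) (c : R) :
  (forall x y, `|f x - f y| <= c) ->
  \sum_x \sum_y (f x - f y) ^+ 2 <= #|T|%:R ^+ 2 * c ^+ 2.
Proof.
move=> fc.
have -> : #|T|%:R ^+ 2 * c ^+ 2 = \sum_(x : T) \sum_(y : T) c ^+ 2.
  by rewrite !sumr_const -mulrnA -[RHS]mulr_natl natrM -expr2.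
apply: ler_sum => x _; apply: ler_sum => y _.
rewrite -[leLHS]real_normK ?num_real// lerXn2r// nnegrE.
by rewrite (le_trans _ (fc x y)).
Qed.

(** An Efron-Stein inequality: each of the [n] coordinates contributes to the
    variance at most the square of the largest change that it can cause. In the
    induction the variance splits into the mean of the variances along the first
    coordinate and the variance of the fibre sums [g]. *)
Lemma sum_sqr_diff_cube n (T : finType) (f : {ffun 'I_n -> T} -> R) (c : R) :
  (forall i (x y : {ffun 'I_n -> T}),
     (forall j, j != i -> x j = y j) -> `|f x - f y| <= c) ->
  \sum_x \sum_y (f x - f y) ^+ 2 <= n%:R * c ^+ 2 * (#|T| ^ n)%:R ^+ 2 *+ 2.
Proof.
elim: n f c => [|n IHn] f c fc.
  rewrite !mul0r mul0rn big1// => x _; rewrite big1// => y _.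
  suff -> : x = y by rewrite subrr expr0n.
  by apply/ffunP => -[].
pose g x := \sum_a f (ffcons a x).
pose t : R := #|T|%:R; pose m : R := (#|T| ^ n)%:R.
have fiber x : \sum_a \sum_b (f (ffcons a x) - f (ffcons b x)) ^+ 2
    <= t ^+ 2 * c ^+ 2.
  apply: sum_sqr_diff_le => a b; apply: (fc ord0) => j.
  by rewrite !ffunE; case: unliftP => [k|] -> //; rewrite eqxx.
have gc i (x y : {ffun 'I_n -> T}) :
    (forall j, j != i -> x j = y j) -> `|g x - g y| <= t * c.
  move=> xy; rewrite /g -sumrB (le_trans (ler_norm_sum _ _ _))//.
  rewrite /t mulr_natl -sumr_const; apply: ler_sum => a _.
  apply: (fc (lift ord0 i)) => j; rewrite !ffunE.
  by case: unliftP => [k|] -> //; rewrite (inj_eq lift_inj) => /xy.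
have := IHn g _ gc; rewrite !sum_sqr_diff !lerMn2r /= !card_ffun !card_ord.
rewrite -/t -/m => gvar.
have split_var : (#|T| ^ n.+1)%:R * (\sum_x f x ^+ 2) - (\sum_x f x) ^+ 2 =
    m * (\sum_x (t * (\sum_a f (ffcons a x) ^+ 2) - g x ^+ 2))
    + (m * (\sum_x g x ^+ 2) - (\sum_x g x) ^+ 2).
  rewrite !sum_ffcons sumrB -mulr_sumr expnS natrM -/t -/m /g; ring.
rewrite split_var expnS natrM -/t -/m.
have m0 : 0 <= m by rewrite ler0n.
have fibers : \sum_x (t * (\sum_a f (ffcons a x) ^+ 2) - g x ^+ 2)
    <= m * (t ^+ 2 * c ^+ 2).
  have -> : m * (t ^+ 2 * c ^+ 2)
      = \sum_(x : {ffun 'I_n -> T}) (t ^+ 2 * c ^+ 2).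
    by rewrite sumr_const card_ffun card_ord mulr_natl.
  apply: ler_sum => x _; have := fiber x; rewrite sum_sqr_diff -/t -/(g x).
  have := sqr_ge0 (t * c); rewrite exprMn.
  by lra.
rewrite (le_trans (lerD (ler_wpM2l m0 fibers) gvar))//.
by rewrite -natr1 le_eqVlt; apply/orP; left; apply/eqP; ring.
Qed.

(** As [s] preserves the counting measure, the mean of [(f k (s x) - f k x) ^ 2]
    is at most four times the variance of [f k]; if its sum over [k] is below
    [e ^ 2], then some [x] works for all [k] at once. *)
Lemma exists_nearly_invariant_point n (T I : finType)
    (s : {ffun 'I_n -> T} -> {ffun 'I_n -> T})
    (f : I -> {ffun 'I_n -> T} -> R) (c e : R) :
  (0 < #|T|)%N -> bijective s ->
  (forall k i (x y : {ffun 'I_n -> T}),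
     (forall j, j != i -> x j = y j) -> `|f k x - f k y| <= c) ->
  #|I|%:R * (8 * n%:R * c ^+ 2) < e ^+ 2 -> 0 <= e ->
  exists x, forall k, `|f k (s x) - f k x| < e.
Proof.
move=> T0 bs fc small e0; apply: contrapT => /forallNP noinv.
pose m : R := (#|T| ^ n)%:R.
have m0 : 0 < m by rewrite ltr0n expn_gt0 T0.
have card_m : #|{ffun 'I_n -> T}| = (#|T| ^ n)%N by rewrite card_ffun card_ord.
have one k : \sum_x (f k (s x) - f k x) ^+ 2 <= 8 * n%:R * c ^+ 2 * m.
  rewrite -(ler_pM2l m0).
  (* Compare both values of f k with its value at an independent point y. *)
  have -> : m * (\sum_x (f k (s x) - f k x) ^+ 2)
      = \sum_x \sum_(y : {ffun 'I_n -> T}) (f k (s x) - f k x) ^+ 2.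
    rewrite mulr_sumr; apply: eq_bigr => x _.
    by rewrite sumr_const card_m mulr_natl.
  apply: (@le_trans _ _ (\sum_x \sum_y ((f k (s x) - f k y) ^+ 2 *+ 2
     + (f k x - f k y) ^+ 2 *+ 2))).
    apply: ler_sum => x _; apply: ler_sum => y _.
    have := sqr_ge0 (f k (s x) - f k y + (f k x - f k y)).
    by nra.
  rewrite (eq_bigr (fun x => (\sum_y (f k (s x) - f k y) ^+ 2) *+ 2
    + (\sum_y (f k x - f k y) ^+ 2) *+ 2)); last first.
    by move=> x _; rewrite big_split /= !sumrMnl.
  have shift : \sum_x \sum_y (f k (s x) - f k y) ^+ 2
      = \sum_x \sum_y (f k x - f k y) ^+ 2.
    by rewrite [RHS](reindex s)//; exact: onW_bij.
  rewrite big_split /= !sumrMnl shift.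
  have := sum_sqr_diff_cube (fc k); rewrite -/m; nra.
have total : \sum_x \sum_k (f k (s x) - f k x) ^+ 2
    <= #|I|%:R * (8 * n%:R * c ^+ 2) * m.
  rewrite exchange_big /= (le_trans (ler_sum _ (fun k _ => one k)))//.
  by rewrite sumr_const -[leLHS]mulr_natl -!mulrA.
suff : m * e ^+ 2 <= \sum_x \sum_k (f k (s x) - f k x) ^+ 2.
  by move=> /le_trans/(_ total); rewrite leNgt [m * _]mulrC (ltr_pM2r m0) small.
rewrite mulr_natl -card_m -sumr_const; apply: ler_sum => x _.
have [k /negP] := (existsNP _).2 (noinv x); rewrite -leNgt => ek.
rewrite (bigD1 k)//= -[leLHS]addr0 lerD//.
  by rewrite -[leRHS]real_normK ?num_real// lerXn2r// nnegrE.
by apply: sumr_ge0 => j _; rewrite sqr_ge0.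
Qed.
End variance.

(** * Finite powers inside a universal homogeneous group *)

Section finite_powers.
Variable R : realType.

Lemma finite_separable (H : valuedZmodType R) :
  finite_set [set: H] -> separable_space H.
Proof.
move=> finH; exists setT; split; first exact: finite_set_countable.
by move=> O O0 _; rewrite setIT.
Qed.

Lemma finite_class_O0 (H : valuedZmodType R) :
  finite_set [set: H] -> class_O0 H.
Proof.
move=> /(finite_image value)/finite_seqP[s vs] x.
pose M := \sum_(v <- s) `|v|.
have vM (y : H) : value y <= M.
  have : [set` s] (value y) by rewrite -vs; exists y.
  rewrite /M /= => /path.splitPr[s1 s2].
  rewrite big_cat big_cons /= addrCA (le_trans (ler_norm _))//.
  by rewrite lerDl addr_ge0// sumr_ge0.
apply: (@squeeze_cvgr _ _ _ _ (fun=> 0) (fun n : nat => M * n%:R^-1)).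
- near=> n; rewrite divr_ge0 ?value_ge0//= ler_wpM2r// invr_ge0//.
- exact: cvg_cst.
- rewrite -(mulr0 M); apply: cvgMr.
  apply/gtr0_cvgV0.
    by near=> n; rewrite ltr0n; near: n; exact: nbhs_infty_gt.
  exact: cvgr_idn.
Unshelve. all: by end_near. Qed.

Lemma finite_subgroup_range (T : finZmodType) (G : zmodType) (k : T -> G) :
  {morph k : x y / x - y} -> finite_subgroup (range k).
Proof.
move=> kB; split; first exact: finite_image.
split=> [|_ _ /set_mem[a _ <-] /set_mem[b _ <-]]; apply/mem_set.
  by exists 0 => //; rewrite -(subrr 0) kB subrr.
by exists (a - b).
Qed.

Variables (r : \bar R) (N : nat) (G : valuedZmodType R).
Variables (T : finZmodType) (k : {additive T -> G}) (n : nat).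

(** The mean makes the diagonal isometric and keeps any upper bound on the
    values. The exponent is [n.+1] because the diagonal map to the empty power
    is not injective. *)
Definition mean_value (x : {ffun 'I_n.+1 -> T}) : R :=
  n.+1%:R^-1 * \sum_i value (k (x i)).

Lemma mean_value_const t : mean_value [ffun=> t] = value (k t).
Proof.
rewrite /mean_value; under eq_bigr do rewrite ffunE.
by rewrite sumr_const card_ord -[X in _ * X]mulr_natl mulKf// pnatr_eq0.
Qed.

Lemma mean_value_ge0 x : 0 <= mean_value x.
Proof.
by rewrite mulr_ge0// ?invr_ge0// sumr_ge0// => i _; exact: value_ge0.
Qed.

Lemma mean_value_eq0 : injective k -> forall x, mean_value x = 0 <-> x = 0.
Proof.
move=> kI x; split=> [|->]; last first.
  have -> : 0 = [ffun=> 0] :> {ffun 'I_n.+1 -> T}.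
    by apply/ffunP => i; rewrite !ffunE.
  by rewrite mean_value_const raddf0; apply/value_eq0.
move=> /eqP; rewrite mulf_eq0 invr_eq0 pnatr_eq0/= psumr_eq0; last first.
  by move=> i _; exact: value_ge0.
move=> /allP x0; apply/ffunP => i; rewrite ffunE; apply: kI; rewrite raddf0.
by apply/value_eq0/eqP; apply: x0; rewrite mem_index_enum.
Qed.

Lemma mean_valueN x : mean_value (- x) = mean_value x.
Proof.
by congr (_ * _); apply: eq_bigr => i _; rewrite ffunE raddfN valueN.
Qed.

Lemma ler_mean_valueD x y :
  mean_value (x + y) <= mean_value x + mean_value y.
Proof.
rewrite -mulrDr ler_wpM2l ?invr_ge0// -big_split ler_sum// => i _.
by rewrite ffunE raddfD ler_valueD.
Qed.

Lemma mean_value_le x : (forall t, ((value (k t))%:E <= r)%E) ->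
  ((mean_value x)%:E <= r)%E.
Proof.
move: r => [s||] kr; rewrite ?leey//; last by have := kr 0.
have {}kr t : value (k t) <= s by rewrite -lee_fin.
rewrite lee_fin ler_pdivrMl// mulr_natl -[in leRHS](card_ord n.+1) -sumr_const.
by apply: ler_sum => i _.
Qed.

(** Universality gives an isometric copy of the power, whose diagonal need not
    be the given copy of [T]. The two copies of [T] are finite
    subgroups, isometrically isomorphic, so homogeneity moves one onto the
    other. *)
Lemma mean_power_embedding : injective k -> frakG r N G ->
    finitely_universal r N G -> finitely_homogeneous G ->
  exists j : {additive {ffun 'I_n.+1 -> T} -> G},
    (forall x, value (j x) = mean_value x) /\ forall t, j [ffun=> t] = k t.
Proof.
move=> kI [_ _ GN Gr] univ homog.
pose H : valuedZmodType R := HB.pack {ffun 'I_n.+1 -> T}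
  (Zmodule_isValued.Build R {ffun 'I_n.+1 -> T}
     mean_value_ge0 (mean_value_eq0 kI) mean_valueN ler_mean_valueD).
have finH : finite_set [set: H] by exact: (@finite_finset {ffun 'I_n.+1 -> T}).
have HG : frakG r N H.
  split; [exact: finite_separable|exact: finite_class_O0| |].
  - move=> x; apply/ffunP => i; apply: (kI).
    by rewrite ffunMnE ffunE raddfMn GN raddf0.
  - by move=> x; apply: mean_value_le => t; exact: Gr.
have [j jV] := univ H finH HG.
pose d t : H := [ffun=> t] : {ffun 'I_n.+1 -> T}.
have dB : {morph d : x y / x - y}.
  by move=> x y; apply/ffunP => i; rewrite !ffunE.
have jdV t : value (j (d t)) = value (k t).
  by rewrite jV; exact: mean_value_const.
have jdI : injective (j \o d).
  move=> t u /= jtu; apply/eqP; rewrite -subr_eq0; apply/eqP/kI.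
  rewrite raddf0; apply/value_eq0.
  by rewrite -jdV dB raddfB jtu subrr; apply/value_eq0.
(* f is the isomorphism between the two copies of T, extended by 0. *)
pose f y := if pselect (exists t, j (d t) = y) is left e
  then k (sval (cid e)) else 0.
have fE t : f (j (d t)) = k t.
  rewrite /f; case: pselect => [e|]; last by case; exists t.
  by congr (k _); apply: jdI; case: cid.
have [F [FV _ Ff]] : exists F : {additive G -> G},
    [/\ isometric F, range F = [set: G] & {in range (j \o d), F =1 f}].
  apply: (homog _ (range k)).
  - by apply: finite_subgroup_range => x y /=; rewrite dB raddfB.
  - by apply: finite_subgroup_range; exact: raddfB.
  - by move=> _ [_ [t _ <-] <-] /=; exists t.
  - move=> _ _ /set_mem[t _ <-] /set_mem[u _ <-] /=.
    have dD : d t + d u = d (t + u) by apply/ffunP => i; rewrite !ffunE.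
    by rewrite -raddfD dD !fE raddfD.
  - by move=> _ /set_mem[t _ <-] /=; rewrite fE jdV.
exists (F \o j : {additive _ -> _}); split=> [x|t] /=; first by rewrite FV jV.
by rewrite Ff ?fE//; apply/mem_set; exists t.
Qed.

End finite_powers.

(** * Concentration along torsion elements *)

Section lipschitz.
Variables (R : realType) (G : valuedZmodType R).

(** The approximation is the infimal convolution of [phi] with [d^-1 * value].
    The slope [d^-1] makes the penalty of a move of length at least [d] exceed
    the range of [phi], so only moves shorter than [d] matter. *)
Lemma lipschitz_approximation (phi : G -> R) (d e : R) : 0 < d ->
    (forall x, 0 <= phi x <= 1) ->
    (forall v x, value v < d -> `|phi (x + v) - phi x| < e) ->
  exists psi : G -> R, (forall x, psi x <= phi x <= psi x + e) /\
    forall x y, `|psi x - psi y| <= d^-1 * value (x - y).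
Proof.
move=> d0 phi01 phi_unif.
pose S x := range (fun v => phi (x + v) + d^-1 * value v).
have Slb x : has_lbound (S x).
  exists 0 => _ [v _ <-]; have /andP[p0 _] := phi01 (x + v).
  by rewrite addr_ge0// mulr_ge0 ?value_ge0// invr_ge0 ltW.
have S0 x : S x !=set0 by exists (phi (x + 0) + d^-1 * value (0 : G)), 0.
have infS x v : inf (S x) <= phi (x + v) + d^-1 * value v.
  by apply: ge_inf => //; exists v.
have value0 : value (0 : G) = 0 by apply/value_eq0.
have lip x y : inf (S x) <= inf (S y) + d^-1 * value (x - y).
  rewrite -lerBlDr; apply: lb_le_inf => // _ [v _ <-].
  rewrite lerBlDr; have := infS x (y + v - x).
  rewrite addrCA subrr addr0 => /le_trans; apply.
  rewrite -[leRHS]addrA lerD2l -mulrDr ler_wpM2l ?invr_ge0 ?(ltW d0)//.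
  rewrite -[y + v - x]addrA addrCA -(valueN (x - y)) opprB.
  exact: ler_valueD.
exists (fun x => inf (S x)); split=> [x|x y].
  have := infS x 0; rewrite addr0 value0 mulr0 addr0 => -> /=.
  rewrite -lerBlDr; apply: lb_le_inf => // _ [v _ <-].
  have [vd|dv] := ltP (value v) d.
    have := phi_unif v x vd; rewrite ltr_norml => /andP[+ _].
    rewrite ltrBrDl => /ltW /le_trans; apply.
    by rewrite lerDl mulr_ge0 ?value_ge0// invr_ge0 ltW.
  have e0 : 0 < e.
    have := phi_unif 0 x; rewrite value0 addr0 subrr normr0; exact.
  have /andP[_ p1] := phi01 x; have /andP[p0 _] := phi01 (x + v).
  have : 1 <= d^-1 * value v by rewrite mulrC ler_pdivlMr// mul1r.
  by move: p1 p0 e0; lra.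
rewrite ler_norml lerBlDl lip andbT lerBrDl lerBlDr.
by rewrite -(valueN (x - y)) opprB lip.
Qed.

End lipschitz.

(** Taking ['I_p.+1] with [p.+1] the order of [g], rather than ['Z_m], also
    covers the trivial group. *)
Lemma torsion_cyclic (G : zmodType) (g : G) : torsion_set g ->
  exists (T : finZmodType) (k : {additive T -> G}) (t : T),
    injective k /\ k t = g.
Proof.
move=> [m m0 gm].
have ex : exists p, (0 < p)%N && (g *+ p == 0) by exists m; rewrite m0 gm eqxx.
case: (ex_minnP ex) => -[//|p] /= /eqP gp pmin.
have gmod i : g *+ (i %% p.+1) = g *+ i.
  by rewrite [in RHS](divn_eq i p.+1) mulrnDr mulnC mulrnA gp mul0rn add0r.
pose k (i : 'I_p.+1) : G := g *+ i.
have kD i j : k (i + j) = k i + k j by rewrite /k gmod mulrnDr.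
have kB : zmod_morphism k.
  by move=> i j; rewrite -[in RHS](subrK j i) [in RHS]kD addrK.
pose K : {additive 'I_p.+1 -> G} :=
  HB.pack k (GRing.isZmodMorphism.Build _ _ k kB).
exists 'I_p.+1, K, (inZp 1); split; last by rewrite /= /k gmod.
apply: raddf_inj => i ki; apply/eqP/contraT => i0.
have i_gt0 : (0 < i)%N by rewrite lt0n.
have := pmin i; rewrite i_gt0 -[g *+ i]/(K i) ki eqxx => /(_ isT).
by rewrite leqNgt ltn_ord.
Qed.

Section concentration.
Variables (R : realType) (G : valuedZmodType R).

(** A weak consequence of concentration of measure on finite subgroups that
    contain [g], which is all that the dynamics of [g] requires. *)
Definition concentrating (g : G) :=
  forall (I : finType) (phi : I -> G -> R) (e : R),
  (forall i x, 0 <= phi i x <= 1) ->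
  (forall i e', 0 < e' ->
     \forall v \near (0 : G), forall x, `|phi i (x + v) - phi i x| < e') ->
  0 < e -> exists h, forall i, `|phi i (h + g) - phi i h| < e.

Lemma near0_value (P : G -> Prop) : (\forall v \near (0 : G), P v) <->
  exists2 d : R, 0 < d & forall v, value v < d -> P v.
Proof.
have dist0 (v : G) : mdist (0 : G) v = value v.
  by rewrite mdist_value sub0r valueN.
rewrite -[X in X <-> _]/(nbhs (0 : G) P).
rewrite -metricType_numDomainType.filter_from_mdist_nbhs.
by split=> -[d d0 dP]; exists d => // v vd; apply: dP; rewrite /= dist0 in vd *.
Qed.

Lemma torsion_concentrating (r : \bar R) (N : nat) (g : G) :
    frakG r N G -> finitely_universal r N G -> finitely_homogeneous G ->
  torsion_set g -> concentrating g.
Proof.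
move=> GG univ homog /torsion_cyclic[T [k [t [kI ktg]]]].
move=> I phi e phi01 phi_unif e0.
have e30 : 0 < e / 3 by rewrite divr_gt0.
have /near0_value[d d0 phid] : \forall v \near (0 : G),
    forall i x, `|phi i (x + v) - phi i x| < e / 3.
  exact: (@filter_forall G I
    (fun i v => forall x, `|phi i (x + v) - phi i x| < e / 3)
    (nbhs (0 : G)) _ (fun i => phi_unif i _ e30)).
have /choice[psi psiP] i := @lipschitz_approximation _ _ (phi i) d (e / 3) d0
  (phi01 i) (fun v x vd => phid v vd i x).
(* D bounds the diameter of the copy of T in G; n is chosen so that
   |I| times eight times the n.+1 squared changes is below (e / 3) ^ 2. *)
pose D := \sum_(u : T) value (k u).
pose K := #|I|%:R * (8 * (d^-1 * D) ^+ 2).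
pose n := Num.bound (K / (e / 3) ^+ 2).
have nK : K / n.+1%:R < (e / 3) ^+ 2.
  have K0 : 0 <= K by do 2 apply: mulr_ge0 => //; exact: sqr_ge0.
  rewrite ltr_pdivrMr// mulrC -ltr_pdivrMr ?exprn_gt0//.
  rewrite (lt_le_trans (archi_boundP _)) ?ler_nat//.
  by rewrite divr_ge0// sqr_ge0.
have [j [jV jk]] := mean_power_embedding n kI GG univ homog.
pose s (x : {ffun 'I_n.+1 -> T}) := x + [ffun=> t].
have sbij : bijective s.
  by exists (fun x => x - [ffun=> t]) => x; rewrite /s ?addrK ?subrK.
have osc i l (x y : {ffun 'I_n.+1 -> T}) :
    (forall l', l' != l -> x l' = y l') ->
    `|psi i (j x) - psi i (j y)| <= d^-1 * D / n.+1%:R.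
  move=> xy; rewrite (le_trans ((psiP i).2 _ _))// -mulrA.
  rewrite ler_wpM2l ?invr_ge0 ?(ltW d0)// -raddfB jV /mean_value mulrC.
  rewrite ler_wpM2r ?invr_ge0// (bigD1 l)//= big1 ?addr0 => [|l' l'l].
    rewrite /D (bigD1 ((x - y) l))//= lerDl sumr_ge0// => u _.
    exact: value_ge0.
  by rewrite !ffunE xy// subrr raddf0; apply/value_eq0.
have [|||x xP] := @exists_nearly_invariant_point _ _ T I s
    (fun i x => psi i (j x))
    (d^-1 * D / n.+1%:R) (e / 3) _ sbij osc.
- by apply/card_gt0P; exists t.
- apply: le_lt_trans nK; rewrite /K exprMn.
  rewrite le_eqVlt; apply/orP; left; apply/eqP.
  have : (n.+1%:R : R) != 0 by rewrite pnatr_eq0.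
  move: (n.+1%:R : R) => q q0.
  by field; rewrite q0 gt_eqF.
- exact: ltW.
exists (j x) => i; have := xP i; rewrite /s raddfD jk ktg.
have /andP[] := (psiP i).1 (j x + g); have /andP[] := (psiP i).1 (j x).
rewrite !ltr_norml => a b c' d' /andP[f h]; apply/andP; split; lra.
Qed.

End concentration.

(** * Actions on compact spaces *)

Lemma compact_finite_subcover (X : topologicalType) (A : set X) (I : choiceType)
    (D : set I) (U : I -> set X) :
  compact A -> A !=set0 -> (forall i, D i -> open (U i)) ->
  A `<=` cover D U -> finite_subset_cover D U A.
Proof.
move=> cA [x0 _].
(* A point of A serves as the base point of X. *)
pose X' : ptopologicalType := HB.pack X (isPointed.Build X x0).
have : @cover_compact X' A by rewrite -compact_cover; exact: cA.
exact.
Qed.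

Lemma closed_coincidence (T X : topologicalType) (f g : T -> X) :
  hausdorff_space X -> continuous f -> continuous g ->
  closed [set t | f t = g t].
Proof.
move=> hX cf cg t clt; apply: hX => A B At Bt.
have ABt : nbhs t (f @^-1` A `&` g @^-1` B).
  by apply: filterI; [exact: cf|exact: cg].
have [z [/= fg [Az Bz]]] := clt _ ABt.
by exists (f z); split; [exact: Az|rewrite fg; exact: Bz].
Qed.

Section dynamics.
Variables (R : realType) (G : valuedZmodType R).
Variables (X : topologicalType) (act : G -> X -> X).
Hypotheses (cX : compact [set: X]) (hX : hausdorff_space X).
Hypothesis actP : continuous_action act.

Lemma action_continuous2 (T : topologicalType) (u : T -> G) (v : T -> X) :
  continuous u -> continuous v -> continuous (fun t => act (u t) (v t)).
Proof.
have [_ _ cact] := actP => cu cv t.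
exact: (cvg_comp (fun t => (u t, v t)) (fun gx : G * X => act gx.1 gx.2)
  (cvg_pair (cu t) (cv t)) (cact (u t, v t))).
Qed.

Lemma action_continuous (g : G) : continuous (act g).
Proof. by apply: action_continuous2 => x; [exact: cvg_cst|exact: cvg_id]. Qed.

Lemma closed_fixed_points (g : G) : closed [set x | act g x = x].
Proof.
apply: closed_coincidence => //; first exact: action_continuous.
by move=> x; exact: cvg_id.
Qed.

(** Uniformity in the space comes from its compactness; it makes the functions
    [h |-> f (act h x)] uniformly continuous on the group. *)
Lemma action_uniform (f : X -> R) (e : R) : continuous f -> 0 < e ->
  \forall v \near (0 : G), forall x, `|f (act v x) - f x| < e.
Proof.
have [act0 _ _] := actP => cf e0.
have cfact : continuous (fun p : X * G => f (act p.2 p.1)).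
  move=> p; apply: (@continuous_comp _ _ _ (fun p => act p.2 p.1) f).
    by apply: action_continuous2 => q; [exact: cvg_snd|exact: cvg_fst].
  exact: cf.
have cfst : continuous (fun p : X * G => f p.1).
  move=> p; apply: (@continuous_comp _ _ _ fst f); first exact: cvg_fst.
  exact: cf.
have near_x (x : X) : \forall x' \near x & v \near (0 : G),
    `|f (act v x') - f x'| < e.
  pose F p := f (act p.2 p.1) - f p.1.
  have F0 : F @ nbhs (x, 0 : G) --> (0 : R).
    rewrite [X in _ --> X](_ : _ = F (x, 0)); last by rewrite /F /= act0 subrr.
    exact: (cvgB (cfact (x, 0 : G)) (cfst (x, 0 : G))).
  exact: (@cvgr0_norm_lt R R _ _ _ F F0 e e0).
have /compact_near_coveringP ncX := cX.
have cov := ncX G (nbhs (0 : G)) (fun v x => `|f (act v x) - f x| < e)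
  (nbhs_filter (0 : G)) (fun x _ => near_x x).
by apply: filterS cov => v vP x; exact: vP.
Qed.

(** If [g] moved every point of [Y], then by Urysohn's lemma and compactness
    finitely many continuous functions [f] would satisfy
    [1 / 2 < `|f (g y) - f y|] for at least one of them at each [y] in [Y];
    this fails at [y = act h x0] for the [h] that concentration provides. *)
Lemma concentrating_fixed_point (g : G) (Y : set X) : concentrating g ->
    closed Y -> Y !=set0 -> (forall h x, Y x -> Y (act h x)) ->
  exists2 y, Y y & act g y = y.
Proof.
have [_ actD _] := actP.
move=> conc_g clY Y0 invY; apply: contrapT => nofix.
pose C : set (X -> R) :=
  [set f : X -> R | continuous f /\ forall x, 0 <= f x <= 1].
pose U (f : X -> R) := [set x | 1 / 2 < `|f (act g x) - f x|].
have openU f : C f -> open (U f).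
  move=> [cf _].
  have cd : continuous (fun x => `|f (act g x) - f x|).
    move=> x; apply: cvg_norm; apply: cvgB; last exact: cf.
    apply: (@continuous_comp _ _ _ (act g) f); last exact: cf.
    exact: action_continuous.
  apply: (@open_comp _ _ (fun x => `|f (act g x) - f x|) [set r | 1 / 2 < r]).
    by move=> x _; exact: cd.
  exact: open_gt.
have coverU : Y `<=` cover C U.
  move=> y Yy.
  have sep : uniform_separator [set y] [set act g y].
    apply: (@normal_completely_regular R X).
    - exact: compact_normal.
    - exact: hausdorff_accessible.
    - exact/accessible_closed_set1/hausdorff_accessible.
    - by move=> /= yg; apply: nofix; exists y.
  exists (Urysohn [set y] [set act g y]).
    split; first exact: Urysohn_continuous.
    move=> x; have := @Urysohn_range X R [set y] [set act g y] _ (imageT _ x).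
    by rewrite /= in_itv.
  rewrite /U /=.
  have -> : Urysohn [set y] [set act g y] y = 0 :> R.
    by apply: (Urysohn_sub0 sep); exists y.
  have -> : Urysohn [set y] [set act g y] (act g y) = 1 :> R.
    by apply: (Urysohn_sub1 sep); exists (act g y).
  by rewrite subr0 normr1; lra.
have cY : compact Y by exact: (subclosed_compact clY cX).
have [F FC YF] := compact_finite_subcover cY Y0 openU coverU.
have [x0 Yx0] := Y0.
have Fprop (f : F) : C (val f) by apply/set_mem/FC/valP.
have [|||h hP] := conc_g F (fun f h => val f (act h x0)) (1 / 2).
- by move=> f x; have [_] := Fprop f; exact.
- move=> f e' e'0; have [cf _] := Fprop f.
  apply: filterS (action_uniform cf e'0) => v vP x.
  by rewrite (addrC x) actD; exact: vP.
- by lra.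
have [f Ff] := YF _ (invY h _ Yx0).
rewrite /U /= -actD (addrC g).
have := hP [` Ff]%fset; rewrite /= => /ltW; rewrite leNgt => /negP hn.
exact: hn.
Qed.

(** The fixed points of [g] in [Y] are again closed and invariant, the latter
    because the group is Abelian. *)
Lemma concentrating_common_fixed_point (s : seq G) (Y : set X) :
    (forall g, g \in s -> concentrating g) ->
    closed Y -> Y !=set0 -> (forall h x, Y x -> Y (act h x)) ->
  exists2 y, Y y & forall g, g \in s -> act g y = y.
Proof.
have [_ actD _] := actP.
elim: s Y => [|g s IHs] Y conc clY Y0 invY.
  by case: Y0 => y Yy; exists y.
pose Z := Y `&` [set y | act g y = y].
have [||||y [Yy gy] sy] := IHs Z.
- by move=> k ks; apply: conc; rewrite inE ks orbT.
- by apply: closedI => //; exact: closed_fixed_points.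
- have cg : concentrating g by apply: conc; rewrite inE eqxx.
  by have [y Yy gy] := concentrating_fixed_point cg clY Y0 invY; exists y.
- move=> h x [Yx gx]; split; first exact: invY.
  by rewrite /= -actD (addrC g) actD gx.
exists y => // k; rewrite inE => /orP[/eqP->//|]; exact: sy.
Qed.

(** Otherwise the complements of the fixed point sets of the elements of [D]
    would cover [X], because the stabilizer of a point is closed and so is the
    whole group as soon as it contains the dense set [D]. *)
Lemma concentrating_dense_fixed_point (D : set G) : dense D ->
  (forall g, D g -> concentrating g) -> [set: X] !=set0 ->
  exists x, forall g, act g x = x.
Proof.
move=> dD concD X0; apply: contrapT => nofix.
have closed_stab x : closed [set g | act g x = x].
  apply: closed_coincidence => //; last exact: cst_continuous.
  apply: (@action_continuous2 _ id (fun=> x)); last exact: cst_continuous.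
  by move=> g; exact: cvg_id.
have [|x _|F FD XF] := @compact_finite_subcover X setT G D
    (fun g => ~` [set x | act g x = x]) cX X0.
- by move=> g _; apply: closed_openC; exact: closed_fixed_points.
- apply: contrapT => xD; apply: nofix; exists x => h; apply: contrapT => hx.
  have [g [/= gx Dg]] := dD (~` [set g | act g x = x])
    (ex_intro _ h hx) (closed_openC (closed_stab x)).
  by apply: xD; exists g.
have concF g : g \in enum_fset F -> concentrating g.
  by move=> /FD/set_mem; exact: concD.
have [x _ xF] := concentrating_common_fixed_point concF closedT X0
  (fun _ _ _ => I).
by have [g gF] := XF x I; apply; exact: xF.
Qed.

End dynamics.

Local Close Scope ring_scope.
Local Close Scope classical_set_scope.

Theorem theorem3p5 (R : realType) (r : \bar R) (N : nat) (G : valuedZmodType R)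
  (hr : r = 1%:E \/ r = +oo%E) (hN : N = 0 \/ 2 <= N) (hG : is_bbG r N G) :
  extremely_amenable G.
Proof.
have [[_ GG] univ homog tors] := hG.
move=> X act cX hX X0 actP.
have dtors : dense (@torsion_set G).
  (* If N > 0, every element is torsion. *)
  have [/tors//|N0] := posnP N.
  have -> : @torsion_set G = setT.
    by rewrite -subTset => g _; exists N => //; case: GG.
  by move=> O O0 _; rewrite setIT.
apply: (concentrating_dense_fixed_point cX hX actP dtors) => // g tg.
exact: torsion_concentrating GG univ homog tg.
Qed.
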